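(* Let $n\ge 2$ and let $D=\partial_{x_1}+\sum_{i=2}^n (a_i(x_1)x_i+b_i(x_1))\partial_{x_i}$ be a simple Shamsuddin derivation of $K[x]$, where $a_i(x_1),b_i(x_1)\in K[x_1]$ for all $2\le i\le n$. Suppose that for every $f\in\operatorname{Aut}(K[x])_D$ one has $f-f(0)\in\operatorname{Aut}(K[x])_D$. Then $\operatorname{Aut}(K[x])_D=\{\mathrm{id}\}$.
   Context: $K$ is a field of characteristic zero, $K[x]=K[x_1,\ldots,x_n]$, and $\partial_{x_i}=\partial/\partial x_i$. A $K$-derivation $D$ of $K[x]$ is a $K$-linear map $K[x]\to K[x]$ with $D(ab)=D(a)b+aD(b)$. A Shamsuddin derivation is a derivation of the form $\partial_{x_1}+\sum_{i=2}^n(a_ix_i+b_i)\partial_{x_i}$ with $a_i,b_i\in K[x_1]$. An ideal $I$ is $D$-stable if $D(I)\subset I$; $D$ is simple if the only $D$-stable ideals of $K[x]$ are $0$ and $K[x]$. Invertible polynomial maps $f=(f_1,\ldots,f_n)$ (polynomial maps $K^n\to K^n$ with a polynomial inverse) are identified with $K$-automorphisms $\rho$ of $K[x]$ via $\rho(g)=g(f_1,\ldots,f_n)$, i.e. $\rho(x_i)=f_i$. $\operatorname{Aut}(K[x])$ is the group of $K$-automorphisms of $K[x]$ and $\operatorname{Aut}(K[x])_D=\{\rho\in\operatorname{Aut}(K[x]) : \rho D=D\rho\}$. Write $f(0)=(f_1(0,\ldots,0),\ldots,f_n(0,\ldots,0))\in K^n$ and $f-f(0)=(f_1-f_1(0),\ldots,f_n-f_n(0))$.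 *)

(* Defs.v *)
From HB Require Import structures.
From mathcomp Require Import all_boot all_order all_algebra.
From mathcomp Require Import mpoly.

Set Implicit Arguments.
Unset Strict Implicit.
Unset Printing Implicit Defensive.

Import GRing.Theory.
Local Open Scope ring_scope.

Definition is_derivation (K : fieldType) (n : nat)
    (D : {mpoly K[n]} -> {mpoly K[n]}) : Prop :=
  linear D /\ forall p q, D (p * q) = D p * q + p * D q.

(* The variables x_1, ..., x_n are 'X_i for i : 'I_n, counted from 0. *)
Definition idx1 (n : nat) (hn : (2 <= n)%N) : 'I_n := Ordinal (ltnW hn).

(* [horner_alg 'X_(idx1 hn) (a i)] is a_i(x_1); the values of [a] and [b]
   at [idx1 hn] are not used. *)
Definition shamsuddin (K : fieldType) (n : nat) (hn : (2 <= n)%N)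
    (a b : 'I_n -> {poly K}) (p : {mpoly K[n]}) : {mpoly K[n]} :=
  p^`M(idx1 hn)
  + \sum_(i < n | i != idx1 hn)
      (horner_alg 'X_(idx1 hn) (a i) * 'X_i + horner_alg 'X_(idx1 hn) (b i))
      * p^`M(i).

Lemma shamsuddin_derivation (K : fieldType) (n : nat) (hn : (2 <= n)%N)
    (a b : 'I_n -> {poly K}) : is_derivation (shamsuddin hn a b).
Proof.
split=> [c p q | p q]; rewrite /shamsuddin.
  rewrite mderivD mderivZ scalerDr [RHS]addrACA; congr (_ + _).
  rewrite [X in _ = X + _]scaler_sumr -big_split /=; apply: eq_bigr => i _.
  by rewrite mderivD mderivZ mulrDr scalerAr.
rewrite mderivM mulrDl mulrDr [RHS]addrACA; congr (_ + _).
rewrite [X in _ = X + _]mulr_suml [X in _ = _ + X]mulr_sumr -big_split /=.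
apply: eq_bigr => i _.
by rewrite mderivM mulrDr mulrA; congr (_ + _); rewrite mulrCA.
Qed.

Definition is_ideal (R : comNzRingType) (I : R -> Prop) : Prop :=
  [/\ I 0, forall p q, I p -> I q -> I (p + q) & forall r p, I p -> I (r * p)].

Definition stable_ideal (R : comNzRingType) (D : R -> R) (I : R -> Prop) :
    Prop :=
  is_ideal I /\ forall p, I p -> I (D p).

Definition simple_derivation (R : comNzRingType) (D : R -> R) : Prop :=
  forall I : R -> Prop, stable_ideal D I ->
    (forall p, I p <-> p = 0) \/ (forall p, I p).

Definition is_Kaut (K : fieldType) (n : nat)
    (rho : {mpoly K[n]} -> {mpoly K[n]}) : Prop :=
  [/\ linear rho, monoid_morphism rho & bijective rho].

Definition isotropy (K : fieldType) (n : nat)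
    (D rho : {mpoly K[n]} -> {mpoly K[n]}) : Prop :=
  is_Kaut rho /\ forall p, rho (D p) = D (rho p).

(* The endomorphism g |-> g(f_1, ..., f_n) with which the polynomial map f
   is identified. *)
Definition pullback (K : fieldType) (n : nat) (f : n.-tuple {mpoly K[n]})
    (g : {mpoly K[n]}) : {mpoly K[n]} := g \mPo f.

Lemma Kaut_pullback (K : fieldType) (n : nat)
    (rho : {mpoly K[n]} -> {mpoly K[n]}) :
  is_Kaut rho -> rho =1 pullback [tuple rho 'X_i | i < n].
Proof.
case=> rho_lin [rho1 rhoM] _ p; rewrite /pullback.
have rho0 : rho 0 = 0.
  by have := rho_lin (- 1) 0 0; rewrite !scaleN1r oppr0 addr0 addNr.
have rhoX (I : Type) (s : seq I) (F : I -> {mpoly K[n]}) :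
    rho (\prod_(i <- s) F i) = \prod_(i <- s) rho (F i).
  by elim/big_rec2: _ => // i x y _ <-; rewrite rhoM.
have rhoE (q : {mpoly K[n]}) k : rho (q ^+ k) = rho q ^+ k.
  by elim: k => [|k IHk]; rewrite ?expr0 // !exprS rhoM IHk.
elim/mpolyind: p => [|c m p _ _ IHp]; first by rewrite rho0 comp_mpoly0.
rewrite rho_lin IHp linearP /=; congr (_ *: _ + _).
rewrite comp_mpolyX mpolyXE_id rhoX; apply: eq_bigr => i _.
by rewrite rhoE tnth_mktuple.
Qed.

(* f - f(0) *)
Definition sub_at0 (K : fieldType) (n : nat) (f : n.-tuple {mpoly K[n]}) :
    n.-tuple {mpoly K[n]} :=
  [tuple tnth f i - ((tnth f i).@[fun _ => 0])%:MP | i < n].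

(* Main.v *)
Require Import Defs.
From mathcomp Require Import all_boot all_order all_algebra.
From mathcomp Require Import mpoly.
From mathcomp Require Import ring.

Set Implicit Arguments.
Unset Strict Implicit.
Unset Printing Implicit Defensive.

Import GRing.Theory.
Local Open Scope ring_scope.

(** Write [D] for the derivation.  Two facts about simplicity carry the proof.

    An automorphism [rho] that commutes with [D] and fixes a point of [K^n] is
    the identity: the ideal generated by all [rho g - g] is [D]-stable and
    vanishes at that point, so it is proper, hence zero.  The map [f - f(0)]
    fixes the origin, so the hypothesis makes every [f] in the isotropy group a
    translation [x + c] ([simple_commuting_id], [isotropy_translation]).

    No coefficient [a_i] is constant: if [a_i = alpha], the equation
    [h' = alpha h + b_i] has a polynomial solution [h], and then
    [D (x_i - h) = alpha (x_i - h)], so [x_i - h] generates a [D]-stable ideal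
    that is neither zero nor the whole ring ([deriv_affine_solvable],
    [simple_nonconstant]).

    A translation by [c] commutes with [D] only if, for all [s] and [t],
    [a_i(s) t + b_i(s) = a_i(s + c_1) (t + c_i) + b_i(s + c_1)].  Comparing
    coefficients of [t], [a_i] has period [c_1]; a periodic polynomial is
    constant in characteristic zero, so [c_1 = 0].  Then [a_i c_i = 0], and
    [c_i = 0] because [a_i] is nonzero. *)

(** * Univariate polynomials in characteristic zero *)

Lemma natr_inj_pchar0 (K : fieldType) :
  [pchar K] =i pred0 -> injective (fun k : nat => k%:R : K).
Proof.
move=> char0; have lt_neq i j : (i < j)%N -> i%:R != j%:R :> K.
  move=> ij; rewrite eq_sym -subr_eq0 -natrB ?(ltnW ij) //.
  by rewrite ((pcharf0P K).1 char0) subn_eq0 -ltnNge.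
move=> i j eq_ij; case: (ltngtP i j) => // /lt_neq; first by rewrite eq_ij eqxx.
by rewrite eq_ij eqxx.
Qed.

Lemma poly_const_on_seq (K : fieldType) (p : {poly K}) (e : nat -> K) (y : K) :
  injective e -> (forall k, p.[e k] = y) -> p = y%:P.
Proof.
move=> e_inj pe; apply/eqP; rewrite -subr_eq0; apply/negPn/negP => q_neq0.
have := max_poly_roots q_neq0 (rs := map e (iota 0 (size (p - y%:P)))).
rewrite size_map size_iota ltnn map_inj_uniq // iota_uniq => /(_ _ isT) H.
apply/notF/H/allP => _ /mapP[k _ ->].
by rewrite /root hornerD hornerN hornerC pe subrr.
Qed.

(** The value at 0 is taken at every multiple [k c], and in characteristic zero
    these are infinitely many points. *)
Lemma periodic_poly_const (K : fieldType) (p : {poly K}) (c : K) :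
    [pchar K] =i pred0 -> c != 0 -> (forall s, p.[s + c] = p.[s]) ->
  p = p.[0]%:P.
Proof.
move=> char0 c_neq0 p_per.
apply: (@poly_const_on_seq _ _ (fun k => k%:R * c)).
  by move=> i j /(mulIf c_neq0)/(natr_inj_pchar0 char0).
elim=> [|k IHk]; first by rewrite mul0r.
by rewrite -natr1 mulrDl mul1r p_per.
Qed.

Lemma antiderivative (K : fieldType) (b : {poly K}) :
  [pchar K] =i pred0 -> exists h : {poly K}, h^`() = b.
Proof.
move=> char0; exists (\poly_(i < (size b).+1) (b`_i.-1 / i%:R)).
apply/polyP=> i; rewrite coef_deriv coef_poly ltnS /=.
case: ltnP => [lt_ib|le_bi]; last by rewrite mul0rn nth_default.
by rewrite -[LHS]mulr_natr divfK // ((pcharf0P K).1 char0).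
Qed.

(** For [alpha = 0] this is integration.  Otherwise induct on the degree of [b],
    which differentiation lowers: if [h1] solves the equation with right-hand
    side [b'], then [(h1 - b) / alpha] solves it for [b], with derivative
    [h1]. *)
Lemma deriv_affine_solvable (K : fieldType) (alpha : K) (b : {poly K}) :
    [pchar K] =i pred0 ->
  exists h : {poly K}, h^`() = alpha *: h + b.
Proof.
move=> char0; have [->|alpha_neq0] := eqVneq alpha 0.
  by have [h hE] := antiderivative b char0; exists h; rewrite scale0r add0r.
have [m] := ubnP (size b); elim: m b => // m IHm b lt_bm.
have [->|b_neq0] := eqVneq b 0.
  by exists 0; rewrite deriv0 scaler0 addr0.
have [|h1 h1E] := IHm b^`().
  by rewrite (leq_trans (lt_size_deriv b_neq0)) // -ltnS.
exists (alpha^-1 *: (h1 - b)).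
by rewrite derivZ derivB h1E addrK !scalerA mulVf // divff // !scale1r subrK.
Qed.

(** * Polynomials in one element of an algebra *)

Lemma horner_algMXaddC (K : fieldType) (A : algType K) (u : A) p c :
  horner_alg u (p * 'X + c%:P) = horner_alg u p * u + c%:A.
Proof. by rewrite rmorphD rmorphM /= horner_algX horner_algC. Qed.

Lemma meval_horner_alg (K : fieldType) n (u : {mpoly K[n]}) p v :
  (horner_alg u p).@[v] = p.[u.@[v]].
Proof.
elim/poly_ind: p => [|p c IHp]; first by rewrite rmorph0 meval0 horner0.
rewrite horner_algMXaddC hornerMXaddC mevalD mevalM IHp.
by rewrite mevalZ meval1 mulr1.
Qed.

(** * Derivations *)

Section Derivation.

Variables (K : fieldType) (n : nat) (D : {mpoly K[n]} -> {mpoly K[n]}).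
Hypothesis D_der : is_derivation D.

Lemma derivationD p q : D (p + q) = D p + D q.
Proof. by have := D_der.1 1 p q; rewrite !scale1r. Qed.

Lemma derivation1 : D 1 = 0.
Proof.
by apply: (@addIr _ (D 1)); rewrite add0r -{3}[1]mulr1 D_der.2 mulr1 mul1r.
Qed.

Lemma derivation0 : D 0 = 0.
Proof. by apply: (@addIr _ (D 0)); rewrite -derivationD !add0r. Qed.

Lemma derivationZ c p : D (c *: p) = c *: D p.
Proof. by have := D_der.1 c p 0; rewrite derivation0 !addr0. Qed.

Lemma derivationB p q : D (p - q) = D p - D q.
Proof. by rewrite derivationD -scaleN1r derivationZ scaleN1r. Qed.

Lemma derivation_horner_alg u p :
  D u = 1 -> D (horner_alg u p) = horner_alg u p^`().
Proof.
move=> Du; elim/poly_ind: p => [|p c IHp].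
  by rewrite deriv0 !rmorph0 derivation0.
rewrite horner_algMXaddC derivationD D_der.2 Du derivationZ derivation1.
rewrite IHp derivD derivM derivX derivC scaler0 !addr0.
by rewrite rmorphD !rmorphM /= horner_algX rmorph1.
Qed.

(** The product rule gives [D (r g) = (D r + r q) g].  This is how simplicity
    excludes eigenvectors other than constants. *)
Lemma eigenvector_ideal (q g : {mpoly K[n]}) :
  D g = q * g -> stable_ideal D (fun p => exists r, p = r * g).
Proof.
move=> Dg; split; first split.
- by exists 0; rewrite mul0r.
- by move=> _ _ [r ->] [s ->]; exists (r + s); rewrite mulrDl.
- by move=> r _ [s ->]; exists (r * s); rewrite mulrA.
by move=> _ [r ->]; exists (D r + r * q); rewrite D_der.2 Dg mulrA mulrDl.
Qed.

(** The ideal generated by all [rho g - g] is [D]-stable, because [D] maps the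
    generator at [g] to the generator at [D g]; as it lies in a proper ideal,
    simplicity makes it zero. *)
Lemma simple_commuting_id (rho : {mpoly K[n]} -> {mpoly K[n]})
    (J : {mpoly K[n]} -> Prop) :
    simple_derivation D -> (forall p, rho (D p) = D (rho p)) ->
    is_ideal J -> ~ J 1 -> (forall g, J (rho g - g)) ->
  rho =1 id.
Proof.
move=> D_simple rhoD J_ideal J1 Jrho.
pose I p := forall L : {mpoly K[n]} -> Prop,
  is_ideal L -> (forall g, L (rho g - g)) -> L p.
have I_ideal : is_ideal I.
  split=> [L [] // | p q Ip Iq L L_id Lrho | r p Ip L L_id Lrho].
    by case: (L_id) => _ LD _; apply: LD; [apply: Ip | apply: Iq].
  by case: (L_id) => _ _ LM; apply: LM; apply: Ip.
have Irho g : I (rho g - g) by move=> L _; apply.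
have I_stable : stable_ideal D I.
  split=> // p Ip; case: (I_ideal) => I0 ID IM.
  (* The p in I with D p in I form an ideal containing the generators, so they
     exhaust I. *)
  suff [] : I p /\ I (D p) by [].
  apply: (Ip (fun p => I p /\ I (D p))).
    split=> [|q r [Iq IDq] [Ir IDr]|r q [Iq IDq]]; first by rewrite derivation0.
      by rewrite derivationD; split; apply: ID.
    by rewrite D_der.2; split; [apply: IM | apply: ID; [apply: IM|apply: IM]].
  by move=> g; rewrite derivationB -rhoD.
case: (D_simple I I_stable) => [I0 g|I_full].
  by apply/subr0_eq; rewrite -I0.
by case: J1; apply: (I_full 1).
Qed.

End Derivation.

(** * Shamsuddin derivations *)

Section Shamsuddin.

Variables (K : fieldType) (n : nat) (hn : (2 <= n)%N) (a b : 'I_n -> {poly K}).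
Hypothesis char0 : [pchar K] =i pred0.

Local Notation D := (shamsuddin hn a b).
Local Notation i1 := (idx1 hn).

Let D_der : is_derivation D := shamsuddin_derivation hn a b.

Lemma mderiv_var (i j : 'I_n) : ('X_j : {mpoly K[n]})^`M(i) = (i == j)%:R.
Proof.
rewrite mderivX mnm1E; have [->|] := eqVneq j i; last by rewrite mulr0n scale0r.
by rewrite scale1r -[X in (X - _)%MM]add0m addmK mpolyX0.
Qed.

Lemma shamsuddin_var1 : D 'X_i1 = 1.
Proof.
rewrite /shamsuddin mderiv_var eqxx big1 ?addr0 // => i /negPf i_neq.
by rewrite mderiv_var i_neq mulr0.
Qed.

Lemma shamsuddin_var (i : 'I_n) : i != i1 ->
  D 'X_i = horner_alg 'X_i1 (a i) * 'X_i + horner_alg 'X_i1 (b i).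
Proof.
move=> i_neq; rewrite /shamsuddin mderiv_var eq_sym (negPf i_neq) add0r.
rewrite (bigD1 i) //= mderiv_var eqxx mulr1 big1 ?addr0 //.
move=> j /andP[_ /negPf jP].
by rewrite mderiv_var jP mulr0.
Qed.

Lemma simple_nonconstant (i : 'I_n) (alpha : K) :
  simple_derivation D -> i != i1 -> a i <> alpha%:P.
Proof.
move=> D_simple i_neq aE.
have [h hE] := deriv_affine_solvable alpha (b i) char0.
set H := horner_alg 'X_i1 h : {mpoly K[n]}.
have Dg : D ('X_i - H) = alpha%:A * ('X_i - H).
  rewrite (derivationB D_der) shamsuddin_var // aE.
  rewrite (derivation_horner_alg D_der _ shamsuddin_var1) hE rmorphD /=.
  rewrite linearZ /= horner_algC -/H -!scalerAl !mul1r scalerBr.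
  by rewrite [X in _ - X]addrC addrKA.
(* X_i - H takes every value t at a point with x_1 = 0. *)
pose v t (j : 'I_n) := if j == i then h.[0] + t else 0.
have gE t : ('X_i - H).@[v t] = t.
  rewrite mevalB mevalXU meval_horner_alg mevalXU /v eqxx.
  by rewrite eq_sym (negPf i_neq) addrC addKr.
case: (D_simple _ (eigenvector_ideal D_der Dg)) => [I0|I_full].
  have /I0 g0 : exists r, 'X_i - H = r * ('X_i - H) by exists 1; rewrite mul1r.
  by have := gE 1; rewrite g0 meval0 => /esym/eqP; rewrite oner_eq0.
have [r /(congr1 (meval (v 0)))] := I_full 1.
by rewrite meval1 mevalM gE mulr0 => /eqP; rewrite oner_eq0.
Qed.

(** Both sides of the commutation relation at [x_i], evaluated at a point with
    [x_1 = s] and [x_i = t]. *)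
Lemma translation_equation (f : n.-tuple {mpoly K[n]}) (c : 'I_n -> K) i :
    (forall j, tnth f j = 'X_j + (c j)%:MP) ->
    (forall p, pullback f (D p) = D (pullback f p)) -> i != i1 ->
  forall s t, (a i).[s] * t + (b i).[s] =
              (a i).[s + c i1] * (t + c i) + (b i).[s + c i1].
Proof.
move=> fE fD i_neq s t; pose v j := if j == i then t else s.
have := congr1 (meval v) (fD 'X_i); rewrite /pullback comp_mpolyXU -tnth_nth fE.
have -> : D ('X_i + (c i)%:MP) = D 'X_i.
  rewrite (derivationD D_der) -[(c i)%:MP]mulr1 mul_mpolyC.
  by rewrite (derivationZ D_der) (derivation1 D_der) scaler0 addr0.
rewrite shamsuddin_var // comp_mpoly_meval !mevalD !mevalM !meval_horner_alg.
rewrite !mevalXU /= !fE !mevalD !mevalXU !mevalC /v eqxx.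
by rewrite eq_sym (negPf i_neq) => ->.
Qed.

(** The map [f - f(0)] fixes the origin, so the ideal of polynomials vanishing
    there contains all [g(f - f(0)) - g], and [f - f(0)] is the identity. *)
Lemma isotropy_translation (f : n.-tuple {mpoly K[n]}) :
    simple_derivation D -> isotropy D (pullback (sub_at0 f)) ->
  forall i, tnth f i = 'X_i + ((tnth f i).@[fun _ => 0])%:MP.
Proof.
move=> D_simple [_ fD] i.
have g_id : pullback (sub_at0 f) =1 id.
  apply: (simple_commuting_id D_der (J := fun p => p.@[fun _ => 0] = 0)) => //.
  - split=> [|p q p0 q0|r p p0]; first exact: meval0.
      by rewrite mevalD p0 q0 addr0.
    by rewrite mevalM p0 mulr0.
  - by rewrite meval1 => /eqP; rewrite oner_eq0.
  move=> g; rewrite mevalB /pullback comp_mpoly_meval; apply/eqP.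
  rewrite subr_eq0; apply/eqP/meval_eq => j.
  by rewrite !tnth_mktuple mevalB mevalC subrr.
have := g_id 'X_i; rewrite /pullback comp_mpolyXU -tnth_nth tnth_mktuple => <-.
by rewrite subrK.
Qed.

End Shamsuddin.

(** * The isotropy group *)

Lemma isotropy_eq (K : fieldType) n
    (D rho sigma : {mpoly K[n]} -> {mpoly K[n]}) :
  rho =1 sigma -> isotropy D rho -> isotropy D sigma.
Proof.
move=> E [[rho_lin [rho1 rhoM] rho_bij] rhoD].
split; last by move=> p; rewrite -!E.
split; first by move=> c p q; rewrite -!E; exact: rho_lin.
  by split=> [|p q]; rewrite -!E ?rhoM.
exact: eq_bij rho_bij _ E.
Qed.

Lemma isotropy_id (K : fieldType) n (D : {mpoly K[n]} -> {mpoly K[n]}) :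
  isotropy D id.
Proof. by split=> //; split=> //; exists id. Qed.

Theorem corollary3p3 (K : fieldType) (n : nat)
    (char0 : [pchar K] =i pred0) (hn : (2 <= n)%N)
    (a b : 'I_n -> {poly K})
    (D_simple : simple_derivation (shamsuddin hn a b))
    (D_shift : forall f : n.-tuple {mpoly K[n]},
       isotropy (shamsuddin hn a b) (pullback f) ->
       isotropy (shamsuddin hn a b) (pullback (sub_at0 f))) :
  forall rho : {mpoly K[n]} -> {mpoly K[n]},
    isotropy (shamsuddin hn a b) rho <-> rho =1 id.
Proof.
move=> rho; split=> [rho_iso|rho_id]; last first.
  by apply: (isotropy_eq (rho := id)) (isotropy_id _) => p; rewrite rho_id.
set f := [tuple rho 'X_i | i < n].
have rhoE : rho =1 pullback f by case: rho_iso => /Kaut_pullback.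
have f_iso := isotropy_eq rhoE rho_iso.
pose c i := (tnth f i).@[fun _ => 0].
have fE : forall i, tnth f i = 'X_i + (c i)%:MP.
  exact: isotropy_translation D_simple (D_shift _ f_iso).
have a_nonconst (i : 'I_n) (alpha : K) : i != idx1 hn -> a i <> alpha%:P.
  by move=> i_neq; apply: (simple_nonconstant char0 D_simple i_neq).
have trans i := translation_equation fE f_iso.2 (i := i).
have a_per i : i != idx1 hn -> forall s, (a i).[s + c (idx1 hn)] = (a i).[s].
  (* Subtract the relation at t = 0 from the one at t = 1. *)
  move=> i_neq s; have e0 := trans i i_neq s 0; have e1 := trans i i_neq s 1.
  have: ((a i).[s] * 1 + (b i).[s]) - ((a i).[s] * 0 + (b i).[s]) = (a i).[s].
    by ring.
  by rewrite e0 e1 => <-; ring.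
have c1 : c (idx1 hn) = 0.
  apply/eqP/negPn/negP => c1_neq0.
  have i_neq : Ordinal hn != idx1 hn by [].
  apply: (a_nonconst _ _ i_neq).
  exact: periodic_poly_const char0 c1_neq0 (a_per _ i_neq).
have c0 i : c i = 0.
  have [->//|i_neq] := eqVneq i (idx1 hn).
  apply/eqP/negPn/negP => ci_neq0; apply: (a_nonconst i 0 i_neq).
  apply: (poly_const_on_seq (natr_inj_pchar0 char0)) => k.
  have := trans i i_neq k%:R 0; rewrite c1 addr0 mulr0 => /addIr/esym/eqP.
  by rewrite add0r mulf_eq0 (negPf ci_neq0) orbF => /eqP.
move=> p; rewrite rhoE /pullback -[RHS]comp_mpoly_id; congr (_ \mPo _).
by apply: eq_from_tnth => i; rewrite tnth_mktuple fE c0 addr0.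
Qed.
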